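(* Every linearly ordered compact metrizable dynamical system is tame$_{\mathbf 1}$. That is: let $X$ be a linearly ordered set whose interval topology is compact and metrizable, and let a topological group $T$ act continuously on $X$ so that every translation $x\mapsto tx$ is linear order preserving; then the enveloping semigroup $E(X,T)$ is first countable.
   Context: The interval topology on a linearly ordered set is the usual order topology. A map $f\colon X\to X$ is linear order preserving if $x\le x'$ implies $f(x)\le f(x')$. The enveloping semigroup $E(X,T)$ is the closure of the set of translations $\{x\mapsto tx:t\in T\}$ in $X^X$ with the pointwise topology. A compact metrizable system is tame$_{\mathbf 1}$ if $E(X,T)$ is first countable. *)

(* Defs.v *)
From HB Require Import structures.
From mathcomp Require Import all_boot all_order all_algebra.
From mathcomp Require Import all_classical all_reals all_analysis.

Set Implicit Arguments.
Unset Strict Implicit.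
Unset Printing Implicit Defensive.

Local Open Scope classical_set_scope.
Local Open Scope ring_scope.

(* MathComp-Analysis only provides additive topological groups; [groupType] is
   the library's multiplicative, possibly infinite and noncommutative, group.
   No separation axiom is imposed. *)
HB.mixin Record isTopologicalGroup G & Topological G & Group G := {
  mulg_continuous : continuous (fun p : G * G => (p.1 * p.2)%g) ;
  invg_continuous : continuous (fun x : G => (x^-1)%g)
}.

#[short(type="topologicalGroupType")]
HB.structure Definition TopologicalGroup :=
  { G of Topological G & Group G & isTopologicalGroup G }.

Record continuous_action (T : topologicalGroupType) (X : topologicalType)
    (act : T -> X -> X) : Prop := ContinuousAction {
  act_one : forall x, act 1%g x = x ;
  act_mul : forall s t x, act (s * t)%g x = act s (act t x) ;
  act_continuous : continuous (fun p : T * X => act p.1 p.2)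
}.

Definition metrizable (R : realType) (X : topologicalType) : Prop :=
  exists dist : X -> X -> R,
    [/\ forall x, dist x x = 0,
        forall x y, dist x y = 0 -> x = y,
        forall x y, dist x y = dist y x,
        forall y x z, dist x z <= dist x y + dist y z
      & forall x, nbhs x =
          filter_from [set e | 0 < e] (fun e => [set y | dist x y < e])].

Definition first_countable (X : topologicalType) : Prop :=
  forall x : X, exists2 B : set (set X), countable B & nbhs x = filter_from B id.

Definition translations (T : Type) (X : topologicalType) (act : T -> X -> X) :
    set {ptws X -> X} :=
  [set act t | t in [set: T]].

Definition enveloping_semigroup (T : Type) (X : topologicalType)
    (act : T -> X -> X) : set {ptws X -> X} :=
  closure (translations act).

(* [set_type] carries the topology induced by the inclusion, here that of
   [{ptws X -> X}]. *)
Definition tame1 (T : Type) (X : topologicalType) (act : T -> X -> X) : Prop :=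
  first_countable (set_type (enveloping_semigroup act)).

(* Main.v *)
Require Import Defs.
From HB Require Import structures.
From mathcomp Require Import all_boot all_order all_algebra finmap.
From mathcomp Require Import all_classical all_reals all_analysis.

(** Every element of the enveloping semigroup is a pointwise limit of monotone
    maps, hence monotone ([closed_homo]), so it suffices that a space of
    monotone maps with the pointwise topology is first countable, as in Helly's
    space ([homo_sub_first_countable]). The space X is compact metrizable, hence
    second countable ([compact_metrizable_second_countable]).

    Fix a monotone f and a countable base of the target. For a basic open set U,
    choose a countable subset D(U) of the preimage of U by f that is coinitial
    and cofinal in it; second countability provides one ([countable_cofinal]).
    The countably many conditions g(d) in U, for U basic and d in D(U),
    determine the neighborhoods of f. Indeed, let I be an open interval around
    f(x), and U a basic open set with f(x) in U and U included in I. Then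
    x1 <= x <= x2 for some x1, x2 in D(U), and a monotone g with g(x1) and g(x2)
    in U satisfies g(x1) <= g(x) <= g(x2), so that g(x) is in I. Choosing the
    points of D(U) inside the preimage of U is what copes with the
    discontinuities of f, at which a dense set of points would not control
    the value. *)

Set Implicit Arguments.
Unset Strict Implicit.
Unset Printing Implicit Defensive.

Import Order.TTheory GRing.Theory Num.Theory.

Local Open Scope classical_set_scope.
Local Open Scope ring_scope.

(** The statement for pseudometric types applies once X carries the uniform
    structure of the distance; a base point is needed for that, so the empty
    space is set apart. *)
Lemma compact_metrizable_second_countable (R : realType) (X : topologicalType) :
  compact [set: X] -> metrizable R X -> @second_countable X.
Proof.
move=> compactX [dist [dist0 _ distC dist_triangle nbhs_dist]].
have [[x0 _]|/forallNP X0] := pselect ([set: X] !=set0); last first.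
  exists set0; [exact: countable0 | split; first exact: sub0set].
  by move=> x; case: (X0 x).
pose dball x e := [set y | dist x y < e].
have center x e : 0 < e -> dball x e x by rewrite /dball /= dist0.
have sym x y e : dball x e y -> dball y e x by rewrite /dball /= distC.
have triangle x y z e1 e2 :
    dball x e1 y -> dball y e2 z -> dball x (e1 + e2) z.
  rewrite /dball /= => xy yz.
  exact: le_lt_trans (dist_triangle y x z) (ltrD xy yz).
have nbhsE : nbhs = nbhs_ (entourage_ dball).
  apply/funext => x; rewrite nbhs_dist; apply/seteqP; split => A [e e0 eA].
    exists [set xy | dball xy.1 e xy.2]; first by exists e.
    by move=> y /xsectionP /eA.
  by case: e0 => r r0 rE; exists r => // y xy; apply/eA/xsectionP/rE.
have ent_filter : Filter (entourage_ dball).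
  apply: filter_from_filter => [|e1 e2 e1_gt0 e2_gt0]; first by exists 1 => /=.
  exists (Num.min e1 e2) => [|xy]; first by rewrite /= lt_min e1_gt0.
  by rewrite /dball /= lt_min => /andP.
have ent_refl A : entourage_ dball A -> diagonal `<=` A.
  by move=> [e e0 eA] [x y] /diagonalP ->; apply: eA; exact: center.
have ent_sym A : entourage_ dball A -> entourage_ dball A^-1%relation.
  by move=> [e e0 eA]; exists e => // xy; rewrite /= => /sym; exact: (eA (_, _)).
have ent_split A : entourage_ dball A ->
    exists2 B, entourage_ dball B & (B \; B `<=` A)%relation.
  move=> [e e0 eA]; exists [set xy | dball xy.1 (e / 2) xy.2].
    by exists (e / 2) => //=; rewrite divr_gt0.
  by move=> [x y] [z xz zy]; apply: eA; rewrite /= (splitr e); exact: triangle zy.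
(* The entourages are packed with the given topology of X kept in place, so
   that the result speaks of X itself. *)
pose uniformX := Nbhs_isUniform_mixin.Build X
  ent_filter ent_refl ent_sym ent_split nbhsE.
pose U : uniformType := HB.pack X uniformX.
pose metricX := Uniform_isPseudoMetric.Build R U center sym triangle erefl.
pose Y : pseudoPMetricType R :=
  HB.pack X (isPointed.Build X x0) uniformX metricX.
exact: (@compact_second_countable R Y).
Qed.

(** This is the Lindelof property: if A has no greatest element, the open sets
    of points strictly below an element of A cover A, and countably many of them
    suffice. Stating it for a total relation gives coinitial sets as well as
    cofinal ones. *)
Lemma countable_cofinal (X : topologicalType) (r : rel X) (A : set X) :
    @second_countable X -> total r -> (forall b, open [set a | ~~ r b a]) ->
  exists2 D : set X, countable D &
    D `<=` A /\ forall a, A a -> exists2 b, D b & r a b.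
Proof.
move=> [B countB [_ Bnbhs]] r_total r_open.
have [[m Am mmax]|nomax] := pselect (exists2 m, A m & forall a, A a -> r a m).
  by exists [set m] => //; split=> [_ -> //|a /mmax]; exists m.
have [[a0 Aa0]|/forallNP A0] := pselect (A !=set0); last first.
  by exists set0 => //; split=> [//|a /A0].
(* For a basic open U lying strictly below some element of A, choose one such
   element; if there is none, the default a0 keeps the choice inside A. *)
pose beyond (U : set X) := [set b | A b /\ U `<=` [set a | ~~ r b a]].
exists [set xget a0 (beyond U) | U in B].
  exact: card_le_trans (card_image_le _ _) countB.
split=> [_ [U _ <-]|a Aa]; first by case: xgetP => [_ -> []|].
have [b Ab nba] : exists2 b, A b & ~~ r b a.
  apply: contra_notP nomax => nob; exists a => // b Ab.
  by apply: contra_notT nob => nba; exists b.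
have [U [BU Ua] Ub] := Bnbhs a _ (open_nbhs_nbhs (conj (r_open b) nba)).
exists (xget a0 (beyond U)); first by exists U.
have [_ /(_ a Ua) /=] : beyond U (xget a0 (beyond U)) by exact: xgetI (conj Ab Ub).
by have /orP[-> //|->] := r_total a (xget a0 (beyond U)).
Qed.

Lemma itv_convex (d : Order.disp_t) (X : orderType d) (i : interval X) x y z :
  x \in i -> z \in i -> (x <= y <= z)%O -> y \in i.
Proof.
case: i => a b; rewrite !itv_boundlr => /andP[ax _] /andP[_ zb] /andP[xy yz].
by rewrite (le_trans ax) ?(le_trans _ zb) ?bnd_simp.
Qed.

Lemma nbhs_countable_subbase (X : topologicalType) (x : X) (S : set (set X)) :
    countable S -> S `<=` nbhs x -> filter_from (finI_from S id) id --> x ->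
  exists2 B : set (set X), countable B & nbhs x = filter_from B id.
Proof.
move=> countS S_nbhs S_cvg; exists (finI_from S id).
  exact: finI_from_countable.
apply/seteqP; split=> [A /S_cvg //|A [_ [F FS <-] FA]].
apply: filterS FA _; apply: filter_bigI => i /FS.
by rewrite inE => /S_nbhs.
Qed.

Lemma ptws_sub_cvg (X : choiceType) (Y : topologicalType) (E : set {ptws X -> Y})
    (F : set_system E) (f : E) : Filter F ->
  (forall x, (fun g : E => set_val g x) @ F --> set_val f x) -> F --> f.
Proof.
move=> FF Ff A [_ [[W Wopen <-] Wf WA]].
have : set_val @ F --> (set_val f : {ptws X -> Y}).
  apply/cvg_sup => x U [_ [[V Vopen <-] Vfx VU]].
  have FV : F [set g : E | V (set_val g x)].
    exact: Ff (open_nbhs_nbhs (conj Vopen Vfx)).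
  by apply: filterS FV => g; exact: VU.
move=> /(_ _ (open_nbhs_nbhs (conj Wopen Wf))) FW.
exact: (@filterS _ F FF (set_val @^-1` W)).
Qed.

Lemma eval_sub_continuous (X : choiceType) (Y : topologicalType)
    (E : set {ptws X -> Y}) (x : X) : continuous (fun f : E => set_val f x).
Proof.
move=> f A /(@proj_continuous X (fun=> Y) x).
exact: (@initial_continuous E {ptws X -> Y} set_val f).
Qed.

(** Spaces of monotone maps between second countable ordered spaces behave like
    Helly's space: countably many well-chosen points of the domain control a
    monotone map near f, because its values elsewhere are squeezed. *)
Lemma homo_sub_first_countable (d d' : Order.disp_t)
    (X : orderTopologicalType d) (Y : orderTopologicalType d')
    (E : set {ptws X -> Y}) :
    @second_countable X -> @second_countable Y ->
    (forall f, E f -> {homo f : x y / (x <= y)%O}) ->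
  first_countable E.
Proof.
move=> countX [B countB [Bopen Bnbhs]] E_homo f.
(* Every point of the preimage of U lies between two points of D U. *)
have /choice[D DP] : forall U : set Y, exists D : set X,
    [/\ countable D, forall x, D x -> U (set_val f x) &
        forall x, U (set_val f x) ->
          exists x1 x2, [/\ D x1, D x2 & (x1 <= x <= x2)%O]].
  move=> U; pose A := [set x | U (set_val f x)].
  have [|b|D1 countD1 [D1A D1P]] := @countable_cofinal X >=%O A countX.
  - by move=> x y; exact: le_total.
  - have := rray_open b; congr open; apply/seteqP.
    by split=> x /=; rewrite in_itv /= andbT -ltNge.
  have [|b|D2 countD2 [D2A D2P]] := @countable_cofinal X <=%O A countX.
  - exact: le_total.
  - have := lray_open b; congr open; apply/seteqP.
    by split=> x /=; rewrite in_itv /= -ltNge.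
  exists (D1 `|` D2); split.
  - by rewrite -bigcup2E; apply: bigcup_countable => // -[|[|?]] _.
  - by move=> x [/D1A|/D2A].
  move=> x Ax; have [x1 D1x1 x1x] := D1P x Ax; have [x2 D2x2 xx2] := D2P x Ax.
  by exists x1, x2; split; [left|right|apply/andP].
pose S := \bigcup_(U in B) [set [set g : E | U (set_val g x)] | x in D U].
have S1 U x : B U -> D U x -> finI_from S id [set g : E | U (set_val g x)].
  by move=> BU DUx; apply: (@finI_from1 _ _ S id); exists U => //; exists x.
apply: (@nbhs_countable_subbase _ f S).
- apply: bigcup_countable => // U BU.
  by apply: card_le_trans (card_image_le _ _) _; have [] := DP U.
- move=> _ [U BU [x DUx <-]]; apply: (@eval_sub_continuous _ _ E x f).
  apply: open_nbhs_nbhs; split; first exact: Bopen.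
  by have [_ + _] := DP U; exact.
have S_filter : Filter (filter_from (finI_from S id) id).
  apply: filter_from_filter => [|P Q SP SQ].
    by exists setT; exists fset0 => //; rewrite set_fset0 bigcap_set0.
  by exists (P `&` Q) => //; exact: finI_fromI.
apply: ptws_sub_cvg => x V; rewrite itv_nbhsE => -[i [iopen fxi] iV].
have [|U [BU Ufx] Ui] := Bnbhs (set_val f x) [set` i].
  by apply: open_nbhs_nbhs; split=> //; exact: itv_open_ends_open.
have [_ _ /(_ x Ufx)[x1 [x2 [Dx1 Dx2 /andP[x1x xx2]]]]] := DP U.
(* Keeping g x1 and g x2 in U keeps g x in the interval i, by monotonicity. *)
exists ([set g : E | U (set_val g x1)] `&` [set g : E | U (set_val g x2)]).
  by apply: finI_fromI; exact: S1.
move=> g [/Ui gx1 /Ui gx2]; apply: iV; apply: (itv_convex gx1 gx2).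
have g_homo := E_homo _ (set_valP g).
by apply/andP; split; exact: g_homo.
Qed.

(** A strict inequality f y < f x is an open condition on f, because it is
    witnessed by neighborhoods of f y and f x that stay strictly ordered. *)
Lemma closed_homo (d d' : Order.disp_t) (X : porderType d)
    (Y : orderTopologicalType d') :
  closed [set f : {ptws X -> Y} | {homo f : x y / (x <= y)%O}].
Proof.
move=> f f_closure x y xy; rewrite leNgt; apply/negP => fyx.
pose eval z := @proj_continuous X (fun=> Y) z f.
(* Two open sets separating f y from f x, one lying entirely below the other:
   rays cut at a point in between, or at f x and f y if there is none. *)
have [U [V [Uopen Ufy Vopen Vfx UV]]] : exists U V : set Y,
    [/\ open U, U (f y), open V, V (f x) &
        forall u v, U u -> V v -> (u < v)%O].
  have [[z /andP[yz zx]]|nz] := pselect (exists z, f y < z < f x)%O.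
    exists `]-oo, z[%classic, `]z, +oo[%classic.
    split; [exact: lray_open|by rewrite set_itvE|exact: rray_open|
            by rewrite set_itvE|].
    by move=> u v; rewrite !set_itvE /=; exact: lt_trans.
  exists `]-oo, f x[%classic, `]f y, +oo[%classic.
  split; [exact: lray_open|by rewrite set_itvE|exact: rray_open|
          by rewrite set_itvE|].
  move=> u v; rewrite !set_itvE /= => ux yv.
  rewrite ltNge; apply/negP => vu; apply: nz.
  by exists v; rewrite yv (le_lt_trans vu).
have Uf : nbhs f [set g | U (g y)].
  exact: eval y U (open_nbhs_nbhs (conj Uopen Ufy)).
have Vf : nbhs f [set g | V (g x)].
  exact: eval x V (open_nbhs_nbhs (conj Vopen Vfx)).
have [g [g_homo [Ugy Vgx]]] := f_closure _ (filterI Uf Vf).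
by have := UV _ _ Ugy Vgx; rewrite ltNge g_homo.
Qed.

Theorem theorem8p8 (R : realType) (d : Order.disp_t)
    (X : orderTopologicalType d) (T : topologicalGroupType)
    (act : T -> X -> X)
    (compactX : compact [set: X])
    (metrizableX : metrizable R X)
    (actP : continuous_action act)
    (act_homo : forall t : T, {homo act t : x y / (x <= y)%O}) :
  tame1 act.
Proof.
have countX := compact_metrizable_second_countable compactX metrizableX.
apply: homo_sub_first_countable => // f Ef; apply: (@closed_homo _ _ X X).
by apply: closureS Ef => _ [t _ <-]; exact: act_homo.
Qed.
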